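(* Let $\dot x = Ax+g(x)$ on $\mathbb{R}^n$, let $\mathcal{M}$ be a $d$-dimensional invariant manifold through the origin tangent there to eigenvectors $e_1,\dots,e_d$ of $A$ with pairwise distinct eigenvalues $\lambda_1,\dots,\lambda_d$, and let $\mu=(\mu_1,\dots,\mu_q):\mathbb{R}^n\to\mathbb{R}^q$ be a differentiable multidimensional observable whose delay-embedding map $S:\mathbb{R}^n\to\mathbb{R}^{pq}$ with timelag $\tau>0$ embeds $\mathcal{M}$ onto $\tilde{\mathcal{M}}=S(\mathcal{M})$ (all as specified in the context). Then the tangent space of $\tilde{\mathcal{M}}$ at the fixed point $y_0=S(0)$ can be expressed as $$T_{y_0}\tilde{\mathcal{M}}=\operatorname{range}\begin{bmatrix}V\operatorname{diag}\left(\left.\frac{\partial\mu_1}{\partial z}\right|_{0}\right)\\ \vdots\\ V\operatorname{diag}\left(\left.\frac{\partial\mu_q}{\partial z}\right|_{0}\right)\end{bmatrix},$$ where $V\in\mathbb{C}^{p\times d}$ is the Vandermonde matrix whose $k$-th column is $(1,\mathrm{e}^{\lambda_k\tau},\mathrm{e}^{2\lambda_k\tau},\dots,\mathrm{e}^{(p-1)\lambda_k\tau})^{\top}$ and $\operatorname{diag}\left(\left.\frac{\partial\mu_\ell}{\partial z}\right|_{0}\right)$ is the $d\times d$ diagonal matrix with diagonal entries $\left.\frac{\partial\mu_\ell}{\partial z_1}\right|_{0},\dots,\left.\frac{\partial\mu_\ell}{\partial z_d}\right|_{0}$.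
   Context: System: $\dot x = Ax+g(x)$, $x\in\mathbb{R}^n$, of class $\mathcal{C}^l$ with $l\in\mathbb{N}^+\cup\{\infty,a\}$ ($a$ = analytic), $g:\mathbb{R}^n\to\mathbb{R}^n$, $g(x)=\mathcal{O}(|x|^2)$, and $A\in\mathbb{R}^{n\times n}$ diagonalizable (over $\mathbb{C}$) with eigenvalues $\lambda_1,\dots,\lambda_n$ and eigenvectors $e_1,\dots,e_n$; $E=[e_1,\dots,e_n]$. The flow map is $F^t(x_0)=x(t,x_0)$, assumed defined for the times used. Modal coordinates: $z=E^{-1}x\in\mathbb{C}^n$. Observables are viewed as functions of $z$ through $\mu_\ell(x)=\mu_\ell(Ez)$, so $\left.\frac{\partial\mu_\ell}{\partial z_k}\right|_{0}=D\mu_\ell(0)e_k$, with $D\mu_\ell(0)$ extended complex-linearly. Invariant manifold: $\mathcal{M}\subset\mathbb{R}^n$ is a $d$-dimensional invariant manifold of the flow containing $0$, with $T_0\mathcal{M}=\operatorname{span}\{e_1,\dots,e_d\}$. Delay embedding: for each component, $S_{\ell}(x)=\big(\mu_\ell(x),\mu_\ell(F^{\tau}(x)),\dots,\mu_\ell(F^{(p-1)\tau}(x))\big)^{\top}\in\mathbb{R}^p$, and $S(x)=(S_1(x)^\top,\dots,S_q(x)^\top)^\top\in\mathbb{R}^{pq}$. The conditions of the (multi-dimensional) Takens embedding theorem are assumed to hold, in the sense that $S|_{\mathcal{M}}:\mathcal{M}\to\tilde{\mathcal{M}}:=S(\mathcal{M})$ is a smooth (at least $C^1$) embedding with smooth inverse.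 The fixed point in the observable space is $y_0=S(0)$. Convention: equalities of tangent spaces with complex spans or ranges are understood after complexification. *)

(* Defs.v *)
From HB Require Import structures.
From mathcomp Require Import all_boot all_order all_algebra complex.
From mathcomp Require Import all_classical all_reals all_analysis.
Set Implicit Arguments.
Unset Strict Implicit.
Unset Printing Implicit Defensive.
Import Order.TTheory GRing.Theory Num.Theory.
Import numFieldNormedType.Exports.
Local Open Scope classical_set_scope.
Local Open Scope ring_scope.
Local Open Scope complex_scope.

Section Smoothness.
Context {R : realType}.

(** [C^k] on an open set [U]. For finite-dimensional [V], continuity of all the
    directional derivatives is continuity of the Frechet derivative. *)
Fixpoint Ck_on {V W : normedModType R} (k : nat) (U : set V) (f : V -> W) :
    Prop :=
  if k is k'.+1 then
    (forall x, U x -> differentiable f x) /\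
    (forall v, Ck_on k' U (fun x => 'D_v f x))
  else forall x, U x -> {for x, continuous f}.

Definition monomial n (h : 'cV[R]_n) (alpha : 'I_n -> nat) : R :=
  \prod_i h i 0 ^+ alpha i.

(** Multi-indices of total degree [k] are enumerated as functions into
    ['I_k.+1]; the series of [f (x + h)] is grouped by total degree and
    converges absolutely as a multiple series. *)
Definition analytic_at n (W : normedModType R) (f : 'cV[R]_n -> W)
    (x : 'cV[R]_n) : Prop :=
  exists (r : R) (c : ('I_n -> nat) -> W), 0 < r /\
    forall h : 'cV[R]_n, `|h| < r ->
      cvgn (series (fun k : nat =>
        \sum_(a : {ffun 'I_n -> 'I_k.+1} | (\sum_i (a i : nat) == k)%N)
          `|monomial h (fun i => a i)| * `|c (fun i => a i)|)) /\
      series (fun k : nat =>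
        \sum_(a : {ffun 'I_n -> 'I_k.+1} | (\sum_i (a i : nat) == k)%N)
          monomial h (fun i => a i) *: c (fun i => a i)) @ \oo --> f (x + h).

Inductive smoothness := Cfin of nat | Cinf | Canalytic.

Definition of_class n (W : normedModType R) (l : smoothness)
    (f : 'cV[R]_n -> W) : Prop :=
  match l with
  | Cfin k => Ck_on k setT f
  | Cinf => forall k, Ck_on k setT f
  | Canalytic => forall x, analytic_at f x
  end.

(** On a set [X] which need not be open, [C^1] means: locally the restriction
    to [X] of a [C^1] map defined on an open set of the ambient space. *)
Definition C1_on_subset {V W : normedModType R} (X : set V) (f : V -> W) :
    Prop :=
  forall x, X x -> exists (U : set V) (h : V -> W),
    [/\ open U, U x, Ck_on 1 U h & forall y, U y -> X y -> h y = f y].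

Definition C1_embedding {V W : normedModType R} (X : set V) (f : V -> W) :
    Prop :=
  C1_on_subset X f /\
  exists g : W -> V, C1_on_subset (f @` X) g /\ (forall x, X x -> g (f x) = x).

Definition submanifold d n (M : set 'cV[R]_n) : Prop :=
  forall x, M x -> exists (U : set 'cV[R]_n) (D : set 'cV[R]_d)
      (phi : 'cV[R]_d -> 'cV[R]_n),
    [/\ open U, U x, open D, C1_embedding D phi & phi @` D = M `&` U].

Definition tangent_space n (M : set 'cV[R]_n) (x : 'cV[R]_n) : set 'cV[R]_n :=
  [set v | exists (eps : R) (gam : R -> 'cV[R]_n),
    [/\ 0 < eps, Ck_on 1 `]-eps, eps[%classic (gam : R^o -> 'cV[R]_n),
        forall t, t \in `]-eps, eps[ -> M (gam t), gam 0 = x &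
        derive1 gam 0 = v]].

End Smoothness.

Section Dynamics.
Context {R : realType}.

Definition solution n (f : 'cV[R]_n -> 'cV[R]_n) (a b : R)
    (x : R -> 'cV[R]_n) : Prop :=
  {within `[a, b]%classic, continuous x} /\
  (forall t : R, t \in `]a, b[ -> is_derive t 1 x (f (x t))).

(** Nothing is required of [F] at times outside [[0, T]]. *)
Definition flow_map n (f : 'cV[R]_n -> 'cV[R]_n) (T : R)
    (F : R -> 'cV[R]_n -> 'cV[R]_n) : Prop :=
  forall x0, F 0 x0 = x0 /\ solution f 0 T (fun t => F t x0).

(** Stated on solutions, forward and backward in time, so that no global
    existence is presupposed. *)
Definition invariant_set n (f : 'cV[R]_n -> 'cV[R]_n) (M : set 'cV[R]_n) : Prop :=
  forall (a b : R) (x : R -> 'cV[R]_n), a <= 0 <= b ->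
    solution f a b x -> M (x 0) -> forall t, t \in `[a, b] -> M (x t).

(** The dimension [\sum_(l < q) p] is [q * p]; this form is the one of block
    columns. *)
Definition delay_map n p q (mu : 'cV[R]_n -> 'cV[R]_q)
    (F : R -> 'cV[R]_n -> 'cV[R]_n) (tau : R) (x : 'cV[R]_n) :
    'cV[R]_(\sum_(l < q) p) :=
  \mxcol_(l < q) \col_(j < p) mu (F (j%:R * tau) x) l 0.

End Dynamics.

Section Complexification.
Context {R : realType}.

Definition cexp (z : R[i]) : R[i] :=
  (expR (complex.Re z))%:C * (cos (complex.Im z) +i* sin (complex.Im z)).

Definition complexify n (T : set 'cV[R]_n) : set 'cV[R[i]]_n :=
  [set w | T (map_mx (@complex.Re R) w) /\ T (map_mx (@complex.Im R) w)].

Definition cspan n d (v : 'I_d -> 'cV[R[i]]_n) : set 'cV[R[i]]_n :=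
  [set w | exists c : 'I_d -> R[i], w = \sum_k c k *: v k].

Definition crange m d (B : 'M[R[i]]_(m, d)) : set 'cV[R[i]]_m :=
  range (fun c : 'cV[R[i]]_d => B *m c).

Definition eigenbasis n (A : 'M[R]_n) (lam : 'I_n -> R[i])
    (e : 'I_n -> 'cV[R[i]]_n) : Prop :=
  (\matrix_(i, k) e k i 0) \in unitmx /\
  (forall k, map_mx (fun a : R => a%:C) A *m e k = lam k *: e k).

(** [D mu_l (0) e_k], the differential at [0] being extended complex-linearly;
    this is the derivative at [0] of [mu_l] with respect to the modal
    coordinate [z_k], where [x = E z]. *)
Definition modal_derivative n q (mu : 'cV[R]_n -> 'cV[R]_q) (l : 'I_q)
    (v : 'cV[R[i]]_n) : R[i] :=
  let mul : 'cV[R]_n -> R^o := fun x => mu x l 0 in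
  'd mul 0 (map_mx (@complex.Re R) v) +i* 'd mul 0 (map_mx (@complex.Im R) v).

Definition delay_vandermonde p d (lam : 'I_d -> R[i]) (tau : R) :
    'M[R[i]]_(p, d) :=
  \matrix_(j < p, k < d) cexp (j%:R * lam k * tau%:C).

End Complexification.

(* Main.v *)
Require Import Defs.
From HB Require Import structures.
From mathcomp Require Import all_boot all_order all_algebra complex.
From mathcomp Require Import all_classical all_reals all_analysis.
From mathcomp Require Import ring lra.
Import Order.TTheory GRing.Theory Num.Theory.
Import numFieldNormedType.Exports.
Local Open Scope classical_set_scope.
Local Open Scope ring_scope.
Local Open Scope complex_scope.

(** The tangent space of an embedded image is the image of the tangent space
    under the differential of the embedding ([tangent_space_image]), so the
    claim reduces to computing the differential at [0] of the delay map [S].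
    The entry of index [(r, j)] of [S] is [mu_r] composed with the flow map of
    time [j tau]; the flow fixes [0], and its differential there is the flow
    [exp (t A)] of the linear part ([flow_is_diff]).  Since [exp (t A)]
    multiplies the eigenvector [e_k] by [exp (lam_k t)], the complexified
    differential of [S] sends [e_k] to the vector with entries
    [exp (j lam_k tau) * (d mu_r / d z_k)], which is the [k]-th column of the
    stacked Vandermonde blocks; as [e_1, ..., e_d] span the complexified
    tangent space of [M], these columns span that of [S M].

    The analytic core is the differential of the flow at the equilibrium.  The
    bound [g x = O(|x|^2)] gives [F^t x = exp (t A) x + O(|x|^2)], uniformly for
    [t] in a bounded interval.  Gronwall's inequality for the energy
    [sum_i x_i^2], together with a barrier argument keeping the trajectory in the
    ball where the bound on [g] holds, yields [|F^t x| <= C |x|]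
    ([solution_growth]).  Hence along a trajectory the nonlinearity is
    [O(|x|^2)], and variation of constants in each modal coordinate ([duhamel],
    [modal_estimate]) turns this into the estimate ([flow_linearization]).

    The matrix [exp (t A)] is defined as [E exp (t Lambda) E^-1] in a complex
    eigenbasis; that it is real follows from the fact that conjugation preserves
    the set of eigenvectors of a real matrix ([linflow_real]). *)

Set Implicit Arguments.
Unset Strict Implicit.
Unset Printing Implicit Defensive.

(** * Real and imaginary parts of complex vectors *)

Lemma Re_sum (R : realType) (I : finType) (F : I -> R[i]) :
  complex.Re (\sum_i F i) = \sum_i complex.Re (F i).
Proof. by apply: (big_morph (@complex.Re R)) => // -[a b] [c d]. Qed.

Lemma Im_sum (R : realType) (I : finType) (F : I -> R[i]) :
  complex.Im (\sum_i F i) = \sum_i complex.Im (F i).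
Proof. by apply: (big_morph (@complex.Im R)) => // -[a b] [c d]. Qed.

Lemma Re_mulmx_real (R : realType) (m n k : nat) (w : 'M[R[i]]_(m, n))
    (y : 'M[R]_(n, k)) :
  map_mx (@complex.Re R) (w *m map_mx (real_complex R) y) =
  map_mx (@complex.Re R) w *m y.
Proof.
apply/matrixP => i j; rewrite !mxE Re_sum; apply: eq_bigr => s _.
by rewrite !mxE; case: (w i s) => a b; simpc.
Qed.

Lemma Im_mulmx_real (R : realType) (m n k : nat) (w : 'M[R[i]]_(m, n))
    (y : 'M[R]_(n, k)) :
  map_mx (@complex.Im R) (w *m map_mx (real_complex R) y) =
  map_mx (@complex.Im R) w *m y.
Proof.
apply/matrixP => i j; rewrite !mxE Im_sum; apply: eq_bigr => s _.
by rewrite !mxE; case: (w i s) => a b; simpc.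
Qed.

(** A real-linear form, applied separately to real and imaginary parts, is
    complex-linear: this is its unique complex-linear extension. *)
Lemma complex_linear_ext_sum (R : realType) (n d : nat)
    (D : {linear 'cV[R]_n -> R^o}) (c : 'I_d -> R[i]) (v : 'I_d -> 'cV[R[i]]_n) :
  let DC w := D (map_mx (@complex.Re R) w) +i* D (map_mx (@complex.Im R) w) in
  DC (\sum_k c k *: v k) = \sum_k c k * DC (v k).
Proof.
move=> DC.
have DC0 : DC 0 = 0.
  have R0 : map_mx (@complex.Re R) (0 : 'cV[R[i]]_n) = 0.
    by apply/matrixP => i j; rewrite !mxE.
  have I0 : map_mx (@complex.Im R) (0 : 'cV[R[i]]_n) = 0.
    by apply/matrixP => i j; rewrite !mxE.
  by rewrite /DC R0 I0 linear0.
have DCD w w' : DC (w + w') = DC w + DC w'.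
  rewrite /DC; simpc; rewrite -!linearD; congr (D _ +i* D _);
  by apply/matrixP => i j; rewrite !mxE; case: (w i j) (w' i j) => [? ?] [].
have DCZ a w : DC (a *: w) = a * DC w.
  rewrite /DC; case: a => a b; simpc.
  rewrite -![_ * D _]linearZ -linearB -linearD; congr (D _ +i* D _);
  by apply/matrixP => i j; rewrite !mxE; case: (w i j) => [? ?].
rewrite (big_morph DC DCD DC0); apply: eq_bigr => k _; exact: DCZ.
Qed.

Lemma real_mulmx (R : realType) (m n k : nat) (B : 'M[R]_(m, n))
    (w : 'M[R[i]]_(n, k)) :
  map_mx (@complex.Re R) (map_mx (real_complex R) B *m w) =
    B *m map_mx (@complex.Re R) w /\
  map_mx (@complex.Im R) (map_mx (real_complex R) B *m w) =
    B *m map_mx (@complex.Im R) w.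
Proof.
by split; apply/matrixP => i j; rewrite !mxE ?Re_sum ?Im_sum; apply: eq_bigr => s _;
  rewrite !mxE; case: (w s j) => a b; simpc.
Qed.

Lemma modal_derivative_sum (R : realType) (n q d : nat)
    (mu : 'cV[R]_n -> 'cV[R]_q) (l : 'I_q) (c : 'I_d -> R[i])
    (v : 'I_d -> 'cV[R[i]]_n) :
  modal_derivative mu l (\sum_k c k *: v k) =
  \sum_k c k * modal_derivative mu l (v k).
Proof. exact: complex_linear_ext_sum. Qed.

(** Complexification commutes with direct images, where a real map [L] acts on
    complex vectors through their real and imaginary parts. *)
Lemma complexify_image (R : realType) (n m : nat)
    (L : 'cV[R]_n -> 'cV[R]_m) (T : set 'cV[R]_n) (y : 'cV[R[i]]_m) :
  complexify (L @` T) y <-> exists2 w, complexify T w & forall s,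
    y s 0 = L (map_mx (@complex.Re R) w) s 0 +i* L (map_mx (@complex.Im R) w) s 0.
Proof.
split=> [[[a Ta La] [b Tb Lb]]|[w [Tr Ti] yE]].
  pose w : 'cV[R[i]]_n := \col_i (a i 0 +i* b i 0).
  have wa : map_mx (@complex.Re R) w = a by apply/colP => i; rewrite !mxE.
  have wb : map_mx (@complex.Im R) w = b by apply/colP => i; rewrite !mxE.
  exists w => [|s]; first by rewrite /complexify /= wa wb.
  by rewrite wa wb La Lb !mxE; case: (y s 0).
split; [exists (map_mx (@complex.Re R) w)|exists (map_mx (@complex.Im R) w)] => //;
  by apply/colP => s; rewrite mxE yE.
Qed.

(** * The linear flow in an eigenbasis *)

Definition eigmx (R : realType) (n : nat) (e : 'I_n -> 'cV[R[i]]_n) :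
    'M[R[i]]_n := \matrix_(i, k) e k i 0.

(** The matrix exponential [exp (t A)], diagonalized.  Taking this as the
    definition makes the action on eigenvectors immediate and leaves only the
    reality of the matrix to be proved. *)
Definition linflow (R : realType) (n : nat) (lam : 'I_n -> R[i])
    (e : 'I_n -> 'cV[R[i]]_n) (t : R) : 'M[R[i]]_n :=
  eigmx e *m diag_mx (\row_k cexp (lam k * t%:C)) *m invmx (eigmx e).

Lemma cexpJ (R : realType) (z : R[i]) : cexp (conjc z) = conjc (cexp z).
Proof.
by case: z => a b; rewrite /cexp /= cosN sinN; simpc.
Qed.

Section Eigenbasis.
Context {R : realType} {n : nat} {A : 'M[R]_n} {lam : 'I_n -> R[i]}
  {e : 'I_n -> 'cV[R[i]]_n} (eig : eigenbasis A lam e).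
Let AC := map_mx (fun a : R => a%:C) A.

Lemma mul_eigmx : AC *m eigmx e = eigmx e *m diag_mx (\row_k lam k).
Proof.
apply/matrixP => i k; have /colP/(_ i) := eig.2 k.
rewrite mul_mx_diag !mxE mulrC => <-; apply: eq_bigr => j _.
by rewrite !mxE.
Qed.

(** The rows of [E^-1] are left eigenvectors of [A]; they are the modal
    coordinate functions. *)
Lemma invmx_eigmx_mul :
  invmx (eigmx e) *m AC = diag_mx (\row_k lam k) *m invmx (eigmx e).
Proof.
have uE : eigmx e \in unitmx := eig.1.
rewrite -[LHS]mulmx1 -(mulmxV uE) mulmxA -(mulmxA (invmx _)) mul_eigmx.
by rewrite !mulmxA (mulVmx uE) mul1mx.
Qed.

(** This covers every eigenvector of [A], not just those of the chosen basis: a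
    modal coordinate of [v] can be nonzero only along some [e_k] with
    [lam k = l].  The generality is what [linflow_real] requires. *)
Lemma linflow_eigenvector (l : R[i]) (v : 'cV[R[i]]_n) (t : R) :
  AC *m v = l *: v -> linflow lam e t *m v = cexp (l * t%:C) *: v.
Proof.
move=> Av; have uE : eigmx e \in unitmx := eig.1.
set c := invmx (eigmx e) *m v.
have Lc : diag_mx (\row_k lam k) *m c = l *: c.
  by rewrite /c mulmxA -invmx_eigmx_mul -mulmxA Av scalemxAr.
suff Dc : diag_mx (\row_k cexp (lam k * t%:C)) *m c = cexp (l * t%:C) *: c.
  by rewrite /linflow -!mulmxA Dc -scalemxAr /c mulKVmx.
apply/colP => k; rewrite mul_diag_mx !mxE.
have /colP/(_ k) := Lc; rewrite mul_diag_mx !mxE -/c => /eqP.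
rewrite -subr_eq0 -mulrBl mulf_eq0 subr_eq0 => /orP[/eqP -> //|/eqP ->].
by rewrite !mulr0.
Qed.

Lemma linflow_eig (k : 'I_n) (t : R) :
  linflow lam e t *m e k = cexp (lam k * t%:C) *: e k.
Proof. exact/linflow_eigenvector/eig.2. Qed.

(** As [A] is real, the conjugate of [e k] is an eigenvector for the conjugate of
    [lam k]; by [linflow_eigenvector] the linear flow and its conjugate agree on
    these vectors, which form a basis. *)
Lemma linflow_real (t : R) :
  linflow lam e t =
    map_mx (real_complex R) (map_mx (@complex.Re R) (linflow lam e t)).
Proof.
set P := linflow lam e t.
have PJ : map_mx conjc P = P.
  have uE : map_mx conjc (eigmx e) \in unitmx by rewrite map_unitmx; exact: eig.1.
  apply: (can_inj (mulmxK uE)).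
  rewrite -map_mxM; apply/matrixP => i k.
  have cE B j : (B *m eigmx e) i j = (B *m e j) i 0.
    by rewrite !mxE; apply: eq_bigr => s _; rewrite !mxE.
  (* On the column [conjc (e k)] both sides equal [conjc (P *m e k)]. *)
  have -> : (P *m map_mx conjc (eigmx e)) i k = (P *m map_mx conjc (e k)) i 0.
    by rewrite !mxE; apply: eq_bigr => s _; rewrite !mxE.
  rewrite (linflow_eigenvector (l := conjc (lam k))); last first.
    rewrite -map_mxZ -eig.2 map_mxM; congr (_ *m _).
    by apply/matrixP => a b; rewrite !mxE; apply/eqP; rewrite eq_complex /= ?oppr0 ?eqxx.
  have -> : conjc (lam k) * t%:C = conjc (lam k * t%:C).
    by case: (lam k) => a b; simpc.
  by rewrite cexpJ mxE cE linflow_eig !mxE [LHS](rmorphM (@conjc R)).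
apply/matrixP => i j; have /matrixP/(_ i j) := PJ.
move: (P) => Q; rewrite !mxE => Pij.
apply/eqP; rewrite eq_complex/= eqxx/=.
have /eqP : complex.Im (conjc (Q i j)) = complex.Im (Q i j) by rewrite Pij.
rewrite -subr_eq0; case: (Q i j) => a b /=.
by rewrite -opprD oppr_eq0 -mulr2n mulrn_eq0.
Qed.
End Eigenbasis.

(** * Scalar differential inequalities and variation of constants *)

Lemma within_continuousM (R : realType) (A : set R) (f g : R -> R) :
  {within A, continuous f} -> {within A, continuous g} ->
  {within A, continuous (fun x => f x * g x)}.
Proof. by move=> cf cg x; exact: (continuousM (cf x) (cg x)). Qed.

Lemma within_continuous_comp (R : realType) (A : set R) (f g : R -> R) :
  continuous f -> continuous g -> {within A, continuous (fun x => f (g x))}.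
Proof.
move=> cf cg; apply: continuous_subspaceT => x.
by apply: continuous_comp; [exact: cg|exact: cf].
Qed.

(** The function [exp (- K t) V t] is nonincreasing. *)
Lemma gronwall (R : realType) (K T : R) (V V' : R -> R) :
  {within `[0, T]%classic, continuous V} ->
  (forall t, t \in `]0, T[ -> is_derive t 1 V (V' t)) ->
  (forall t, t \in `]0, T[ -> V' t <= K * V t) ->
  forall t, t \in `[0, T] -> V t <= expR (K * t) * V 0.
Proof.
move=> cV dV leV t tT.
pose W s := expR (- K * s) * V s.
have dW s : s \in `]0, T[ -> is_derive s 1 W (expR (- K * s) * (V' s - K * V s)).
  move=> /dV dVs; rewrite /W.
  have -> : expR (- K * s) * (V' s - K * V s) =
    expR (- K * s) *: V' s + V s *: (expR (- K * s) *: - K).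
    by rewrite /GRing.scale/=; ring.
  have dE : is_derive s 1 (fun s => expR (- K * s)) (expR (- K * s) *: - K).
    have dl : is_derive s 1 ( *%R (- K)) (- K).
      by apply: is_derive_eq; rewrite /GRing.scale/= mulr1.
    exact: (@is_derive1_comp R expR _ s).
  exact: is_deriveM.
have cW : {within `[0, T]%classic, continuous W}.
  apply: within_continuousM cV; apply: within_continuous_comp.
    exact: continuous_expR.
  exact: mulrl_continuous.
have : W t <= W 0.
  move: (tT); rewrite in_itv/= => /andP[t0 tT'].
  apply: (ler0_derive1_le_cc _ _ cW) => //.
  - by move=> s /dW[].
  - move=> s sT; rewrite derive1E; have [_ ->] := dW _ sT.
    by rewrite mulr_ge0_le0 ?expR_ge0// subr_le0 leV.
  - by rewrite in_itv/= lexx (le_trans t0).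
rewrite /W mulr0 expR0 mul1r mulNr expRN => le.
by rewrite -ler_pdivrMl ?expR_gt0.
Qed.

(** The differential inequality is only available while [V] stays below [r], and
    it also keeps [V] below [r]: at the first time [c] with [r <= V c], Gronwall's
    inequality on [[0, c]] would give [V c < r]. *)
Lemma gronwall_barrier (R : realType) (K T r : R) (V V' : R -> R) :
  0 <= K -> 0 <= V 0 ->
  {within `[0, T]%classic, continuous V} ->
  (forall t, t \in `]0, T[ -> is_derive t 1 V (V' t)) ->
  (forall t, t \in `]0, T[ -> V t < r -> V' t <= K * V t) ->
  expR (K * T) * V 0 < r ->
  forall t, t \in `[0, T] -> V t <= expR (K * T) * V 0.
Proof.
move=> K0 V0 cV dV leV ltr t tT.
have mono s : s <= T -> expR (K * s) * V 0 <= expR (K * T) * V 0.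
  by move=> sT; rewrite ler_wpM2r// ler_expR ler_wpM2l.
suff below s : s \in `[0, T] -> V s < r.
  move: (tT); rewrite in_itv/= => /andP[_ t1].
  apply: le_trans (mono _ t1); apply: gronwall cV dV _ _ tT => s sT.
  by apply/leV/below => //; exact: subset_itv_oo_cc.
move=> sT; rewrite ltNge; apply/negP => rV.
(* The set of times at which the barrier is reached is compact, hence has a
   least element. *)
pose B := [set u | r <= V u] `&` `[0, T]%classic.
have Bs : B s by split.
have cB : compact B.
  apply: (subclosed_compact _ (@segment_compact _ 0 T)); last by move=> u [].
  have cI : closed (`[0, T]%classic : set R) by exact: interval_closed.
  have : closed ([set u | r <= V u] : set (subspace `[0, T]%classic)).
    exact: ((@continuous_closedP (subspace _) _ V).1 cV _ (@closed_ge R r)).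
  by rewrite -closed_setIS.
have [c cin cmin] : exists2 c, c \in B & forall u, u \in B -> c <= u.
  apply: (@compact_EVT_min _ R id B) => //; first by exists s.
  by apply: continuous_subspaceT => u; exact: cvg_id.
move: cin; rewrite inE => -[rc /=]; rewrite in_itv/= => /andP[c0 cT].
have sub u : u \in `]0, c[ -> u \in `]0, T[.
  by rewrite !in_itv/= => /andP[-> uc]; rewrite (lt_le_trans uc).
suff : V c <= expR (K * c) * V 0.
  by move=> /le_trans/(_ (mono _ cT))/le_lt_trans/(_ ltr); rewrite ltNge [r <= _]rc.
apply: (@gronwall _ _ c _ V'); last by rewrite in_itv/= c0 lexx.
- apply: continuous_subspaceW cV => u /=; rewrite !in_itv/= => /andP[-> uc].
  by rewrite (le_trans uc).
- by move=> u /sub/dV.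
- move=> u uc; apply: leV; first exact: sub.
  rewrite ltNge; apply/negP => rVu.
  have /cmin : u \in B.
    by rewrite inE; split => //=; exact/subset_itv_oo_cc/sub.
  by move: uc; rewrite in_itv/= leNgt => /andP[_ ->].
Qed.

(** Real form of the variation of constants formula for [z = p + i q],
    [z' = (a + i b) z + (G + i H)].  With [t] fixed, the real part [P s] of
    [exp ((a + i b) (t - s)) * z s] interpolates between the free evolution at
    [s = 0] and [p t] at [s = t], and only the forcing contributes to its
    derivative, so the mean value theorem applied to [P] is enough. *)
Lemma duhamel (R : realType) (T a b eta : R) (p q G H : R -> R) :
  0 <= eta -> {within `[0, T]%classic, continuous p} ->
  {within `[0, T]%classic, continuous q} ->
  (forall t, t \in `]0, T[ -> is_derive t 1 p (a * p t - b * q t + G t)) ->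
  (forall t, t \in `]0, T[ -> is_derive t 1 q (b * p t + a * q t + H t)) ->
  (forall t, t \in `]0, T[ -> `|G t| <= eta /\ `|H t| <= eta) ->
  forall t, t \in `[0, T] ->
    `|p t - expR (a * t) * (cos (b * t) * p 0 - sin (b * t) * q 0)| <=
      expR (`|a| * T) * (eta + eta) * T.
Proof.
move=> eta0 cp cq dp dq GH t; rewrite in_itv/= => /andP[t0 tT].
have T0 : 0 <= T := le_trans t0 tT.
pose P s := expR (a * (t - s)) * (cos (b * (t - s)) * p s - sin (b * (t - s)) * q s).
pose P' s := expR (a * (t - s)) * (cos (b * (t - s)) * G s - sin (b * (t - s)) * H s).
have sub s : s \in `]0, t[ -> s \in `]0, T[.
  by rewrite !in_itv/= => /andP[-> st]; rewrite (lt_le_trans st).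
have dl (c s : R) : is_derive s 1 (fun s => c * (t - s)) (- c).
  apply: is_derive_eq; rewrite /GRing.scale/=; ring.
have dP s : s \in `]0, t[ -> is_derive s 1 P (P' s).
  move=> /sub sT; have dps := dp s sT; have dqs := dq s sT.
  have dE : is_derive s 1 (fun s => expR (a * (t - s))) (expR (a * (t - s)) * - a).
    exact: (@is_derive1_comp R expR _ s _ _ _ (dl a s)).
  have dC : is_derive s 1 (fun s => cos (b * (t - s))) (- sin (b * (t - s)) * - b).
    exact: (@is_derive1_comp R cos _ s _ _ _ (dl b s)).
  have dS : is_derive s 1 (fun s => sin (b * (t - s))) (cos (b * (t - s)) * - b).
    exact: (@is_derive1_comp R sin _ s _ _ _ (dl b s)).
  have dM := is_deriveM dE (is_deriveB (is_deriveM dC dps) (is_deriveM dS dqs)).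
  apply: (is_derive_eq dM); rewrite /P' /GRing.scale/=.
  rewrite -![(_ - _ : _ -> _) _]/(_ - _) -![(_ * _ : _ -> _) _]/(_ * _); ring.
have cl (c : R) : continuous (fun s => c * (t - s)).
  by move=> s; apply/differentiable_continuous/derivable1_diffP; case: (dl c s).
have sub' : `[0, t]%classic `<=` `[0, T]%classic.
  by move=> u /=; rewrite !in_itv/= => /andP[-> ut]; rewrite (le_trans ut).
have cP : {within `[0, t]%classic, continuous P}.
  have cp' := continuous_subspaceW sub' cp.
  have cq' := continuous_subspaceW sub' cq.
  apply: within_continuousM.
    by apply: within_continuous_comp (cl a); exact: continuous_expR.
  apply: within_continuousB; apply: within_continuousM => //.
    by apply: within_continuous_comp (cl b); exact: continuous_cos.
  by apply: within_continuous_comp (cl b); exact: continuous_sin.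
have P0 : P 0 = expR (a * t) * (cos (b * t) * p 0 - sin (b * t) * q 0).
  by rewrite /P subr0.
have Pt : P t = p t.
  by rewrite /P subrr !mulr0 expR0 cos0 sin0 mul0r subr0 !mul1r.
rewrite -P0 -Pt; have [tp|t_le0] := ltP 0 t; last first.
  have -> : t = 0 by apply/le_anti; rewrite t_le0.
  by rewrite subrr normr0 !mulr_ge0 ?expR_ge0 ?addr_ge0.
have [c cin ->] := MVT tp dP cP.
have [Gc Hc] := GH _ (sub _ cin).
move: cin; rewrite in_itv/= => /andP[c0 ct].
rewrite subr0 normrM (ger0_norm t0) ler_pM// normrM (ger0_norm (expR_ge0 _)).
apply: ler_pM; rewrite ?expR_ge0//.
  rewrite ler_expR; apply: (le_trans (ler_norm _)).
  rewrite normrM ler_wpM2l// ger0_norm ?subr_ge0 ?(ltW ct)//.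
  by rewrite (le_trans _ tT)// gerBl ltW.
apply: (le_trans (ler_normB _ _)); rewrite !normrM.
have cos1 : `|cos (b * (t - c))| <= 1 by rewrite ler_norml cos_geN1 cos_le1.
have sin1 : `|sin (b * (t - c))| <= 1 by rewrite ler_norml sin_geN1 sin_le1.
by apply: lerD; rewrite -[leRHS]mul1r ler_pM.
Qed.

(** * Linearization of a nonlinear flow at an equilibrium *)

Lemma coord_le_norm (R : realType) (n : nat) (x : 'cV[R]_n) (i : 'I_n) :
  `|x i 0| <= `|x|.
Proof.
rewrite [leRHS]mx_normrE.
exact: (le_bigmax _ (fun ij : 'I_n * 'I_1 => `|x ij.1 ij.2|) (i, 0)).
Qed.

Lemma norm_le_coord (R : realType) (n : nat) (x : 'cV[R]_n) (c : R) :
  0 <= c -> (forall i, `|x i 0| <= c) -> `|x| <= c.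
Proof.
move=> c0 xc; rewrite [leLHS]mx_normrE; apply: bigmax_le => //= -[i j] _ /=.
by rewrite (ord1 j).
Qed.

Lemma mulmx_bounded (R : realType) (m n : nat) (B : 'M[R]_(m, n)) :
  exists2 c, 0 <= c & forall x : 'cV[R]_n, `|B *m x| <= c * `|x|.
Proof.
have row0 i : 0 <= \sum_j `|B i j| by apply: sumr_ge0.
exists (\sum_i \sum_j `|B i j|); first exact: sumr_ge0.
move=> x; apply: norm_le_coord => [|i].
  by rewrite mulr_ge0// sumr_ge0.
rewrite mxE (le_trans (ler_norm_sum _ _ _))//.
apply: (@le_trans _ _ ((\sum_j `|B i j|) * `|x|)).
  rewrite mulr_suml ler_sum// => j _.
  by rewrite normrM ler_wpM2l// coord_le_norm.
by rewrite ler_wpM2r// (bigD1 i)//= lerDl sumr_ge0.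
Qed.

Lemma mulmx_continuous (R : realType) (m n : nat) (B : 'M[R]_(m, n)) :
  continuous (fun x : 'cV[R]_n => B *m x).
Proof.
have [c c0 Bc] := mulmx_bounded B.
apply: (@bounded_linear_continuous R _ _ (mulmx B)).
apply/linear_boundedP; near=> r => x.
by apply: (le_trans (Bc x)); rewrite ler_wpM2r.
Unshelve. all: by end_near.
Qed.

Lemma is_derive_mulmx (R : realType) (n : nat) (u : 'rV[R]_n)
    (x : R -> 'cV[R]_n) (t : R) (v : 'cV[R]_n) :
  is_derive t 1 x v ->
  is_derive t 1 (fun s => (u *m x s) 0 0) ((u *m v) 0 0).
Proof.
move=> [dx xv].
have dxi i : is_derive t 1 (fun s => x s i 0) (v i 0).
  split; first exact: ((derivable_mxP x t 1).1 dx).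
  by rewrite -xv derive_mx// mxE.
have -> : (fun s => (u *m x s) 0 0) = \sum_i (u 0 i *: (fun s => x s i 0)).
  by apply/funext => s; rewrite mxE fct_sumE.
by rewrite mxE; apply: is_derive_sum => i; exact: is_deriveZ.
Qed.

Lemma within_continuous_mulmx (R : realType) (n : nat) (u : 'rV[R]_n) (I : set R)
    (x : R -> 'cV[R]_n) : {within I, continuous x} ->
  {within I, continuous (fun s => (u *m x s) 0 0)}.
Proof.
move=> cx s.
have cu := @mulmx_continuous R 1 n u (x s).
have c00 := @coord_continuous R 1 1 0 0 (u *m x s).
exact: (@continuous_comp (subspace I) _ _ x (fun y => (u *m y) 0 0) s (cx s)
  (@continuous_comp _ _ _ (mulmx u) (fun M => M 0 0) (x s) cu c00)).
Qed.

(** The energy [V = sum_i x_i^2] is used in place of the sup norm because it is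
    differentiable; it is comparable to the squared norm up to the factor [n],
    and satisfies [V' <= 2 n K V] as long as the solution stays in the ball of
    radius [r]. *)
Lemma solution_growth (R : realType) (n : nat) (f : 'cV[R]_n -> 'cV[R]_n)
    (K r T : R) : 0 <= K -> 0 < r -> 0 <= T ->
  (forall y, `|y| < r -> `|f y| <= K * `|y|) ->
  exists2 C, 1 <= C & forall x, solution f 0 T x -> C * `|x 0| < r ->
    forall t, t \in `[0, T] -> `|x t| <= C * `|x 0|.
Proof.
move=> K0 r0 T0 fK.
pose L := K *+ 2 *+ n.
have L0 : 0 <= L by rewrite !mulrn_wge0.
pose E := expR (L * T) *+ n.
have E0 : 0 <= E by rewrite mulrn_wge0// expR_ge0.
(* [1 + E] rather than [sqrt E]: its square also dominates [E]. *)
exists (1 + E) => [|x [cx dx] small t tT]; first by rewrite lerDl.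
pose V s := \sum_i x s i 0 ^+ 2.
have normV s : `|x s| ^+ 2 <= V s.
  have [x0|] := eqVneq (mx_norm (x s)) 0.
    by rewrite [`|x s|]x0 expr0n/=; apply: sumr_ge0 => i _; exact: sqr_ge0.
  move=> /mx_norm_neq0[[i j] xi]; rewrite [`|x s|]xi/= (ord1 j) real_normK ?num_real//.
  by rewrite /V (bigD1 i)//= lerDl sumr_ge0// => k _; exact: sqr_ge0.
have Vnorm s : V s <= `|x s| ^+ 2 *+ n.
  have -> : `|x s| ^+ 2 *+ n = \sum_(i < n) `|x s| ^+ 2.
    by rewrite sumr_const card_ord.
  apply: ler_sum => i _.
  by rewrite -(@real_normK _ (x s i 0)) ?num_real// lerXn2r ?nnegrE// coord_le_norm.
pose V' s := \sum_i 2 * x s i 0 * f (x s) i 0.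
have coordE i : (fun s => x s i 0) = (fun s => (row i 1%:M *m x s) 0 0).
  by apply/funext => s; rewrite -row_mul mul1mx mxE.
have dV s : s \in `]0, T[ -> is_derive s 1 V (V' s).
  move=> /dx dxs.
  have -> : V = \sum_i (fun s => x s i 0) ^+ 2.
    by apply/funext => u; rewrite fct_sumE.
  apply: is_derive_sum => i.
  have dxi : is_derive s 1 (fun s => x s i 0) (f (x s) i 0).
    rewrite coordE; apply: (is_derive_eq (is_derive_mulmx _ dxs)).
    by rewrite -row_mul mul1mx mxE.
  by apply: (is_derive_eq (is_deriveX 2 dxi)); rewrite /= expr1.
have cV : {within `[0, T]%classic, continuous V}.
  move=> s; apply: (cvg_big (op := +%R)) => [|i _]; first exact: add_continuous.
  have cxi : {within `[0, T]%classic, continuous (fun s => x s i 0)}.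
    by rewrite coordE; exact: within_continuous_mulmx.
  exact: (within_continuousM cxi cxi).
have leV s : s \in `]0, T[ -> V s < r ^+ 2 -> V' s <= L * V s.
  move=> _ Vr; have xr : `|x s| < r.
    by rewrite -(@ltr_pXn2r _ 2) ?nnegrE ?(ltW r0)// (le_lt_trans (normV s)).
  apply: (@le_trans _ _ (L * `|x s| ^+ 2)); last by rewrite ler_wpM2l.
  have -> : L * `|x s| ^+ 2 = \sum_(i < n) 2 * `|x s| * (K * `|x s|).
    by rewrite sumr_const card_ord /L -[RHS]mulr_natr -[K *+ 2 *+ n]mulr_natr; ring.
  apply: ler_sum => i _; apply: (le_trans (ler_norm _)).
  rewrite !normrM ger0_norm// ler_pM ?mulr_ge0//.
    by rewrite ler_wpM2l// coord_le_norm.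
  by rewrite (le_trans (coord_le_norm _ _))// fK.
have Ex0 : expR (L * T) * V 0 <= ((1 + E) * `|x 0|) ^+ 2.
  apply: (@le_trans _ _ (E * `|x 0| ^+ 2)).
    have -> : E * `|x 0| ^+ 2 = expR (L * T) * (`|x 0| ^+ 2 *+ n).
      by rewrite /E mulrnAl mulrnAr.
    by rewrite ler_wpM2l ?expR_ge0.
  rewrite exprMn ler_wpM2r ?sqr_ge0//.
  by rewrite sqrrD; nra.
have V0 s : 0 <= V s by apply: le_trans (normV s); exact: sqr_ge0.
rewrite -(@ler_pXn2r _ 2) ?nnegrE ?mulr_ge0 ?addr_ge0//.
apply: (le_trans (normV t)); apply: (le_trans _ Ex0).
apply: (gronwall_barrier L0 (V0 0) cV dV leV _ tT).
apply: (le_lt_trans Ex0); rewrite ltr_pXn2r ?nnegrE ?(ltW r0)//.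
by rewrite mulr_ge0// addr_ge0.
Qed.

(** A left eigenvector [w] decouples the system: [z = w x] solves
    [z' = l z + w (f x - A x)], to which [duhamel] applies.  The constant depends
    only on [w], [l] and [T], so that [eta] can later be taken quadratic in the
    initial condition. *)
Lemma modal_estimate (R : realType) (n : nat) (A : 'M[R]_n)
    (f : 'cV[R]_n -> 'cV[R]_n) (w : 'rV[R[i]]_n) (l : R[i]) (T : R) :
  w *m map_mx (real_complex R) A = l *: w -> 0 <= T ->
  exists2 C, 0 <= C & forall eta x, 0 <= eta -> solution f 0 T x ->
    (forall t, t \in `]0, T[ -> `|f (x t) - A *m x t| <= eta) ->
    forall t, t \in `[0, T] ->
    let z := (w *m map_mx (real_complex R) (x t)) 0 0 -
             cexp (l * t%:C) * (w *m map_mx (real_complex R) (x 0)) 0 0 in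
    `|complex.Re z| <= C * eta /\ `|complex.Im z| <= C * eta.
Proof.
move=> wA T0.
pose u := map_mx (@complex.Re R) w; pose v := map_mx (@complex.Im R) w.
pose a := complex.Re l; pose b := complex.Im l.
have uA : u *m A = a *: u - b *: v.
  rewrite /u -Re_mulmx_real wA; apply/matrixP => i j; rewrite !mxE /a /b.
  by case: (l) (w i j) => [? ?] [? ?].
have vA : v *m A = b *: u + a *: v.
  rewrite /v -Im_mulmx_real wA; apply/matrixP => i j; rewrite !mxE /a /b addrC.
  by case: (l) (w i j) => [? ?] [? ?].
have [cu cu0 ub] := mulmx_bounded u; have [cv cv0 vb] := mulmx_bounded v.
pose c := cu + cv.
exists (expR (`|a| * T) * (c + c) * T).
  by rewrite !mulr_ge0 ?expR_ge0 ?addr_ge0.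
move=> eta x eta0 [cx dx] fA t tT.
have Cx y : (w *m map_mx (real_complex R) y) 0 0 = (u *m y) 0 0 +i* (v *m y) 0 0.
  rewrite -Re_mulmx_real -Im_mulmx_real !mxE.
  by case: (\sum_j _).
pose p s := (u *m x s) 0 0; pose q s := (v *m x s) 0 0.
pose G s := (u *m (f (x s) - A *m x s)) 0 0.
pose H s := (v *m (f (x s) - A *m x s)) 0 0.
have entryB (M N : 'M[R]_1) : (M - N) 0 0 = M 0 0 - N 0 0 by rewrite !mxE.
have entryD (M N : 'M[R]_1) : (M + N) 0 0 = M 0 0 + N 0 0 by rewrite !mxE.
have entryZ k (M : 'M[R]_1) : (k *: M) 0 0 = k * M 0 0 by rewrite mxE.
have dp s : s \in `]0, T[ -> is_derive s 1 p (a * p s - b * q s + G s).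
  move=> /dx dxs; apply: (is_derive_eq (is_derive_mulmx u dxs)).
  rewrite /G mulmxBr mulmxA uA mulmxBl -!scalemxAl !entryB !entryZ.
  by rewrite -/(p s) -/(q s); ring.
have dq s : s \in `]0, T[ -> is_derive s 1 q (b * p s + a * q s + H s).
  move=> /dx dxs; apply: (is_derive_eq (is_derive_mulmx v dxs)).
  rewrite /H mulmxBr mulmxA vA mulmxDl -!scalemxAl !entryB !entryD !entryZ.
  by rewrite -/(p s) -/(q s); ring.
have dNp s : s \in `]0, T[ -> is_derive s 1 (- p) (b * q s + a * (- p) s + - G s).
  by move=> /dp dps; apply: (is_derive_eq (is_deriveN dps)); rewrite fctE; ring.
have dq' s : s \in `]0, T[ -> is_derive s 1 q (a * q s - b * (- p) s + H s).
  by move=> /dq dqs; apply: (is_derive_eq dqs); rewrite fctE; ring.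
have cp : {within `[0, T]%classic, continuous p} := within_continuous_mulmx cx.
have cq : {within `[0, T]%classic, continuous q} := within_continuous_mulmx cx.
have cNp : {within `[0, T]%classic, continuous (- p)}.
  by move=> s; exact: (continuousN (cp s)).
have GH s : s \in `]0, T[ -> `|G s| <= c * eta /\ `|H s| <= c * eta.
  move=> /fA fs; split; apply: (le_trans (coord_le_norm _ _)).
    apply: (le_trans (ub _)); apply: ler_pM => //; by rewrite lerDl.
  apply: (le_trans (vb _)); apply: ler_pM => //; by rewrite lerDr.
have HG s : s \in `]0, T[ -> `|H s| <= c * eta /\ `|- G s| <= c * eta.
  by move=> /GH[? ?]; rewrite normrN.
have ce : 0 <= c * eta by rewrite mulr_ge0// addr_ge0.
have P := duhamel ce cp cq dp dq GH tT.
(* The equations are invariant under [(p, q, G, H) -> (q, -p, H, -G)],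
   multiplication of [z] by [-i], so the imaginary part is covered as well. *)
have Q := duhamel ce cq cNp dq' dNp HG tT.
have -> : expR (`|a| * T) * (c + c) * T * eta =
    expR (`|a| * T) * (c * eta + c * eta) * T by ring.
rewrite /= !Cx -/(p t) -/(p 0) -/(q t) -/(q 0).
have -> : cexp (l * t%:C) =
    (expR (a * t) * cos (b * t)) +i* (expR (a * t) * sin (b * t)).
  rewrite /cexp /a /b; case: (l) => a' b' /=.
  by rewrite !(mulr0, subr0, add0r); simpc.
simpc; rewrite /=; split.
  apply: (le_trans _ P); rewrite le_eqVlt; apply/orP; left; apply/eqP; congr `|_|; ring.
apply: le_trans Q; rewrite le_eqVlt; apply/orP; left; apply/eqP.
by rewrite fctE; congr `|_|; ring.
Qed.

(** Solutions starting at [x 0] grow at most linearly in [|x 0|], so the forcing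
    of each modal coordinate is quadratic in [|x 0|]; summing the modal errors
    against the eigenvectors preserves this order. *)
Lemma flow_linearization (R : realType) (n : nat) (A : 'M[R]_n)
    (f : 'cV[R]_n -> 'cV[R]_n) (lam : 'I_n -> R[i]) (e : 'I_n -> 'cV[R[i]]_n)
    (T C1 r : R) :
  eigenbasis A lam e -> 0 <= T -> 0 <= C1 -> 0 < r ->
  (forall y, `|y| < r -> `|f y - A *m y| <= C1 * `|y| ^+ 2) ->
  exists C delta, 0 < delta /\ forall x, solution f 0 T x -> `|x 0| < delta ->
    forall t, t \in `[0, T] ->
    `|x t - map_mx (@complex.Re R) (linflow lam e t) *m x 0| <= C * `|x 0| ^+ 2.
Proof.
move=> eig T0 C10 r0 fA.
have [cA cA0 Ab] := mulmx_bounded A.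
have fK y : `|y| < r -> `|f y| <= (cA + C1 * r) * `|y|.
  move=> yr; rewrite -[f y](subrK (A *m y)) (le_trans (ler_normD _ _))//.
  rewrite mulrDl addrC lerD// (le_trans (fA _ yr))// expr2 mulrA.
  by rewrite ler_wpM2r// ler_wpM2l// ltW.
have K0 : 0 <= cA + C1 * r by rewrite addr_ge0// mulr_ge0// ltW.
have [C2 C21 growth] := solution_growth K0 r0 T0 fK.
have C20 : 0 < C2 := lt_le_trans ltr01 C21.
pose w k := row k (invmx (eigmx e)).
have wA k : w k *m map_mx (real_complex R) A = lam k *: w k.
  rewrite /w -row_mul (invmx_eigmx_mul eig); apply/rowP => j.
  by rewrite mxE mul_diag_mx !mxE.
have /choice[C3 C3P] : forall k, exists C, 0 <= C /\ forall eta x, 0 <= eta ->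
    solution f 0 T x -> (forall t, t \in `]0, T[ -> `|f (x t) - A *m x t| <= eta) ->
    forall t, t \in `[0, T] ->
    let z := (w k *m map_mx (real_complex R) (x t)) 0 0 -
             cexp (lam k * t%:C) * (w k *m map_mx (real_complex R) (x 0)) 0 0 in
    `|complex.Re z| <= C * eta /\ `|complex.Im z| <= C * eta.
  by move=> k; have [C ? ?] := modal_estimate f (wA k) T0; exists C.
pose E := eigmx e.
pose W i k := (`|complex.Re (E i k)| + `|complex.Im (E i k)|) * C3 k.
have W0 i k : 0 <= W i k.
  by rewrite mulr_ge0 ?addr_ge0//; have [] := C3P k.
(* The radius [r / C2] keeps the whole trajectory in the ball of radius [r]. *)
exists ((\sum_i \sum_k W i k) * (C1 * C2 ^+ 2)), (r / C2).
split=> [|x sx small t tT]; first exact: divr_gt0.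
have small' : C2 * `|x 0| < r by rewrite mulrC -ltr_pdivlMr.
pose eta := C1 * (C2 * `|x 0|) ^+ 2.
have eta0 : 0 <= eta by rewrite mulr_ge0// sqr_ge0.
have fe s : s \in `]0, T[ -> `|f (x s) - A *m x s| <= eta.
  move=> /subset_itv_oo_cc sT; have xs := growth x sx small' s sT.
  apply: (le_trans (fA _ (le_lt_trans xs small'))).
  by rewrite ler_wpM2l// lerXn2r ?nnegrE// (le_trans _ xs).
have -> : (\sum_i \sum_k W i k) * (C1 * C2 ^+ 2) * `|x 0| ^+ 2 =
    (\sum_i \sum_k W i k) * eta by rewrite /eta; ring.
pose D := diag_mx (\row_k cexp (lam k * t%:C)).
pose z := invmx E *m map_mx (real_complex R) (x t) -
  D *m (invmx E *m map_mx (real_complex R) (x 0)).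
have uE : E \in unitmx := eig.1.
have -> : x t - map_mx (@complex.Re R) (linflow lam e t) *m x 0 =
    map_mx (@complex.Re R) (E *m z).
  rewrite -Re_mulmx_real /z mulmxBr mulKVmx// !mulmxA -/(linflow lam e t).
  move: (linflow lam e t *m _) => N.
  by apply/matrixP => i j; rewrite !mxE; case: (N i j).
apply: norm_le_coord => [|i].
  by rewrite mulr_ge0// sumr_ge0// => i _; exact: sumr_ge0.
apply: (@le_trans _ _ ((\sum_k W i k) * eta)); last first.
  by rewrite ler_wpM2r// [leRHS](bigD1 i)//= lerDl sumr_ge0// => j _; exact: sumr_ge0.
rewrite !mxE Re_sum mulr_suml (le_trans (ler_norm_sum _ _ _))//.
apply: ler_sum => k _.
have := (C3P k).2 eta x eta0 sx fe t tT.
have -> : (w k *m map_mx (real_complex R) (x t)) 0 0 -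
   cexp (lam k * t%:C) * (w k *m map_mx (real_complex R) (x 0)) 0 0 = z k 0.
  have rowM (N : 'cV[R[i]]_n) : (w k *m N) 0 0 = (invmx E *m N) k 0.
    by rewrite /w -row_mul mxE.
  rewrite /z !rowM; move: (invmx E *m _) (invmx E *m _) => X Y.
  by rewrite mul_diag_mx !mxE.
rewrite /W /=; case: (E i k) (z k 0) => [a b] [c d] /= [cb db].
apply: (le_trans (ler_normB _ _)); rewrite !normrM -mulrA mulrDl.
by apply: lerD; apply: ler_pM.
Qed.

Lemma is_diff_quadratic (R : realType) (m n : nat) (h : 'cV[R]_n -> 'cV[R]_m)
    (B : 'M[R]_(m, n)) (C r : R) : 0 < r ->
  (forall y, `|y| < r -> `|h y - B *m y| <= C * `|y| ^+ 2) ->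
  is_diff (0 : 'cV[R]_n) h (mulmx B).
Proof.
move=> r0 hB.
have h0 : h 0 = 0.
  have := hB 0; rewrite normr0 => /(_ r0).
  by rewrite mulmx0 subr0 expr0n/= mulr0 normr_le0 => /eqP.
have exp0 : h \o shift 0 = cst (h 0) + mulmx B +o_ (0 : 'cV[R]_n) id.
  apply/eqaddoP => eps eps0; rewrite h0.
  have C0 : 0 < `|C| + 1 by rewrite ltr_wpDl.
  have near_lt (c : R) : 0 < c -> \forall y \near nbhs (0 : 'cV[R]_n), `|y| < c.
    by move=> c0; exact: (@nbhs0_lt R 'cV[R]_n c c0).
  near=> y.
  rewrite -![(_ + _ : _ -> _) _]/(_ + _) -![(- _ : _ -> _) _]/(- _) /= addr0 add0r.
  have yr : `|y| < r by near: y; exact: near_lt.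
  have ye : `|y| < eps / (`|C| + 1) by near: y; apply: near_lt; exact: divr_gt0.
  apply: (le_trans (hB _ yr)); rewrite expr2 mulrA ler_wpM2r//.
  apply: (@le_trans _ _ ((`|C| + 1) * `|y|)).
    by rewrite ler_wpM2r// (le_trans (ler_norm C))// lerDl.
  by rewrite mulrC -ler_pdivlMr// ltW.
have dE : 'd h (0 : 'cV[R]_n) = mulmx B :> (_ -> _).
  apply: (@diff_unique R _ _ h (mulmx B) 0) => //; exact: mulmx_continuous.
apply: DiffDef => //.
by apply/diff_locallyP; rewrite dE; split => //; exact: mulmx_continuous.
Unshelve. all: by end_near.
Qed.

Lemma flow_is_diff (R : realType) (n : nat) (A : 'M[R]_n)
    (g : 'cV[R]_n -> 'cV[R]_n) (lam : 'I_n -> R[i]) (e : 'I_n -> 'cV[R[i]]_n)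
    (T : R) (F : R -> 'cV[R]_n -> 'cV[R]_n) :
  eigenbasis A lam e ->
  g =O_ (0 : 'cV[R]_n) (fun x => `|x| ^+ 2 : R^o) ->
  flow_map (fun x => A *m x + g x) T F ->
  forall t, t \in `[0, T] -> F t 0 = 0 /\ is_diff (0 : 'cV[R]_n) (F t)
    (mulmx (map_mx (@complex.Re R) (linflow lam e t))).
Proof.
move=> eig gO flow t tT.
have T0 : 0 <= T by move: tT; rewrite in_itv/= => /andP[/le_trans]; apply.
have [C C0 [r /= r0 gC]] : exists2 C : R, 0 < C & exists2 r : R, 0 < r &
    forall y : 'cV[R]_n, `|y| < r -> `|g y| <= C * `|y| ^+ 2.
  have [C C0 /nbhs_ballP[r r0 gC]] := pinfty_ex_gt0 ((eqOP _ _ _).1 gO).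
  exists C => //; exists r => // y yr.
  have := gC y; rewrite mx_norm_ball /ball_/= sub0r normrN => /(_ yr).
  by rewrite (ger0_norm (sqr_ge0 _)).
have fC y : `|y| < r -> `|A *m y + g y - A *m y| <= C * `|y| ^+ 2.
  by move=> /gC; rewrite addrAC subrr add0r.
have [D [delta [d0 FD]]] := flow_linearization eig T0 (ltW C0) r0 fC.
have FP y : `|y| < delta ->
    `|F t y - map_mx (@complex.Re R) (linflow lam e t) *m y| <= D * `|y| ^+ 2.
  by move=> yd; have [F0 sol] := flow y; have := FD _ sol; rewrite F0; apply.
split; last exact: is_diff_quadratic d0 FP.
have := FP 0; rewrite normr0 mulmx0 subr0 expr0n/= mulr0 => /(_ d0).
by rewrite normr_le0 => /eqP.
Qed.

(** * Tangent spaces of embedded images *)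

Lemma differential_col_sum (R : realType) (m : nat) (W : normedModType R)
    (h : 'cV[R]_m -> W) (y w : 'cV[R]_m) : differentiable h y ->
  'd h y w = \sum_i w i 0 *: 'D_(delta_mx i 0) h y.
Proof.
move=> dh; rewrite [w in LHS]matrix_sum_delta linear_sum/=.
by apply: eq_bigr => i _; rewrite big_ord1 linearZ deriveE.
Qed.

(** The derivative of [h] along the curve is written as a finite sum of partial
    derivatives of [h] weighted by the coordinates of the velocity, because
    [Ck_on] only provides continuity of directional derivatives in each fixed
    direction. *)
Lemma C1_curve_comp (R : realType) (m : nat) (W : normedModType R)
    (U : set 'cV[R]_m) (h : 'cV[R]_m -> W) (I : set R) (gam : R -> 'cV[R]_m) :
  open I -> Ck_on 1 I (gam : R^o -> 'cV[R]_m) -> Ck_on 1 U h ->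
  (forall t, I t -> U (gam t)) -> Ck_on 1 I (h \o gam : R^o -> W).
Proof.
move=> oI [dg cg] [dh ch] IU; split=> [t It|v t It].
  by have := @differentiable_comp R R^o _ _ gam h t (dg _ It) (dh _ (IU _ It)).
have chain : \forall s \near t, \sum_i ('D_v (gam : R^o -> _) s) i 0 *:
    'D_(delta_mx i 0) h (gam s) = 'D_v (h \o gam : R^o -> W) s.
  have := open_nbhs_nbhs (conj oI It); apply: filterS => s Is.
  rewrite -differential_col_sum; last exact/dh/IU.
  have dgs : differentiable (gam : R^o -> _) s := dg s Is.
  have dhs : differentiable h (gam s) := dh _ (IU s Is).
  have dhgs : differentiable (h \o gam : R^o -> W) s.
    exact: (@differentiable_comp R R^o).
  by rewrite (deriveE _ dgs) (deriveE _ dhgs) (diff_comp dgs dhs).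
rewrite /prop_for /continuous_at.
rewrite -(nbhs_singleton chain).
apply: cvg_trans; first exact: (near_eq_cvg chain).
apply: (cvg_big (op := +%R)) => [|i _]; first exact: add_continuous.
have cgam : {for t, continuous (gam : R^o -> _)}.
  by apply: differentiable_continuous; exact: dg.
apply: cvgZ.
  have ci := @coord_continuous R m 1 i 0 ('D_v (gam : R^o -> _) t).
  exact: (@continuous_comp R _ R ('D_v (gam : R^o -> _)) (fun M => M i 0) t
    (cg v t It) ci).
have cD := ch (delta_mx i 0) _ (IU _ It).
exact: (continuous_comp cgam cD).
Qed.

Lemma derive1_curve_comp (R : realType) (m : nat) (W : normedModType R)
    (h : 'cV[R]_m -> W) (gam : R -> 'cV[R]_m) t :
  differentiable (gam : R^o -> _) t -> differentiable h (gam t) ->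
  derive1 (h \o gam) t = 'd h (gam t) (derive1 gam t).
Proof.
move=> dg dh.
have dhg : differentiable (h \o gam : R^o -> W) t by exact: (@differentiable_comp R R^o).
by rewrite (derive1E' dg) (derive1E' dhg) (diff_comp dg dh).
Qed.

(** A map which is [C1] on [X] extends locally to a [C1] map on an open set, so
    it sends a short piece of a [C1] curve in [X] to a [C1] curve. *)
Lemma C1_on_curve (R : realType) (n m : nat) (X : set 'cV[R]_n)
    (f : 'cV[R]_n -> 'cV[R]_m) (eps : R) (gam : R -> 'cV[R]_n) :
  C1_on_subset X f -> 0 < eps ->
  Ck_on 1 `]-eps, eps[%classic (gam : R^o -> 'cV[R]_n) ->
  (forall t, t \in `]-eps, eps[ -> X (gam t)) ->
  exists delta (c : R -> 'cV[R]_m), [/\ 0 < delta, delta <= eps,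
    Ck_on 1 `]-delta, delta[%classic (c : R^o -> 'cV[R]_m) &
    forall t, t \in `]-delta, delta[ -> c t = f (gam t)].
Proof.
move=> Cf e0 Cg Xg.
have g0 : 0 \in `]-eps, eps[ by rewrite in_itv/= oppr_lt0 e0.
have [U [h [oU U0 Ch hf]]] := Cf _ (Xg _ g0).
have cont0 : {for (0 : R), continuous gam}.
  by apply: (@differentiable_continuous _ R^o); apply: Cg.1.
have /nbhs_ballP[del /= del0 delU] := cont0 _ (open_nbhs_nbhs (conj oU U0)).
pose delta := Num.min del eps.
have d0 : 0 < delta by rewrite lt_min del0.
have de : delta <= eps by rewrite ge_min lexx orbT.
have sub t : t \in `]-delta, delta[ -> (t \in `]-eps, eps[) /\ U (gam t).
  rewrite !in_itv/= => /andP[t1 t2]; split.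
    by rewrite (le_lt_trans _ t1) ?lerN2//= (lt_le_trans t2).
  apply: delU; rewrite /ball/= sub0r normrN.
  by rewrite (lt_le_trans (_ : `|t| < delta)) ?ltr_norml ?t1// ge_min lexx.
exists delta, (h \o gam); split=> //.
  apply: (C1_curve_comp (U := U)) => //.
  - split=> [t /sub[tE _]|v t /sub[tE _]]; first exact: Cg.1.
    exact: Cg.2.
  - by move=> t /sub[].
move=> t tI; have [tE Ut] := sub _ tI.
by rewrite /= hf//; apply: Xg.
Qed.

(** Curves in [X] are pushed forward by [S] and curves in [S @` X] are pulled
    back by its [C1] inverse; in both directions the curve in the image is, near
    [0], the composite of [S] with the curve in [X], and the chain rule with the
    ambient differential of [S] relates their velocities. *)
Lemma tangent_space_image (R : realType) (n m : nat) (X : set 'cV[R]_n)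
    (S : 'cV[R]_n -> 'cV[R]_m) (x : 'cV[R]_n) :
  X x -> differentiable S x -> C1_embedding X S ->
  tangent_space (S @` X) (S x) = 'd S x @` tangent_space X x.
Proof.
move=> Xx dS [CS [g [Cg gS]]]; apply/seteqP; split=> v.
  case=> eps [gam [e0 Cgam SX gam0 <-]].
  have [del [c [d0 de Cc cg]]] := C1_on_curve Cg e0 Cgam SX.
  have Sc t : t \in `]-del, del[ -> X (c t) /\ S (c t) = gam t.
    move=> tI; rewrite cg//.
    have [|y Xy <-] := SX t; last by rewrite gS.
    move: tI; rewrite !in_itv/= => /andP[t1 t2].
    by rewrite (le_lt_trans _ t1) ?lerN2//= (lt_le_trans t2).
  have I0 : 0 \in `]-del, del[ by rewrite in_itv/= oppr_lt0 d0.
  have c0 : c 0 = x by rewrite cg// gam0 gS.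
  exists (derive1 c 0).
    by exists del, c; split=> // t /Sc[].
  rewrite -c0 -derive1_curve_comp ?c0//; last exact: Cc.1.
  rewrite !derive1E; apply: near_eq_derive.
  near=> t; have [|_ <-//] := Sc t.
  by near: t; exact: near_in_itvoo.
case=> w [eps [gam [e0 Cgam gX gam0 <-]] <-].
have [del [c [d0 de Cc cS]]] := C1_on_curve CS e0 Cgam gX.
have I0 : 0 \in `]-del, del[ by rewrite in_itv/= oppr_lt0 d0.
have sub t : t \in `]-del, del[ -> t \in `]-eps, eps[.
  rewrite !in_itv/= => /andP[t1 t2].
  by rewrite (le_lt_trans _ t1) ?lerN2//= (lt_le_trans t2).
exists del, c; split=> //.
- by move=> t tI; exists (gam t); [exact/gX/sub|rewrite cS].
- by rewrite cS// gam0.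
rewrite -gam0 -derive1_curve_comp ?gam0//; last exact/Cgam.1/sub.
rewrite !derive1E; apply: near_eq_derive.
near=> t; rewrite cS//.
by near: t; exact: near_in_itvoo.
Unshelve. all: by end_near.
Qed.

(** * The delay map *)

Lemma differentiable_cV (R : realType) (V : normedModType R) (m : nat)
    (h : V -> 'cV[R]_m) (x : V) :
  (forall i, differentiable (fun y => h y i 0) x) -> differentiable h x.
Proof.
move=> dh.
have -> : h = \sum_i (fun y => h y i 0 *: (delta_mx i 0 : 'cV[R]_m)).
  apply/funext => y; rewrite [LHS]matrix_sum_delta fct_sumE.
  by apply: eq_bigr => i _; rewrite big_ord1.
by apply: differentiable_sum => i; exact: differentiableZl.
Qed.

Lemma diff_coord (R : realType) (V : normedModType R) (m : nat)
    (h : V -> 'cV[R]_m) (x v : V) (i : 'I_m) :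
  differentiable h x -> 'd h x v i 0 = 'd (fun y => h y i 0) x v.
Proof.
move=> dh.
have dhi : differentiable (fun y => h y i 0) x.
  exact: (@differentiable_comp _ _ _ _ h (fun M => M i 0) x dh
    (differentiable_coord _ _ _)).
by rewrite -!deriveE// derive_mx ?mxE//; exact: diff_derivable.
Qed.

(** On complex vectors the differential of the delay map at [0] is the modal
    derivative of [mu] after the linear flow. *)
Lemma delay_map_diff (R : realType) (n p q : nat) (A : 'M[R]_n)
    (g : 'cV[R]_n -> 'cV[R]_n) (lam : 'I_n -> R[i]) (e : 'I_n -> 'cV[R[i]]_n)
    (mu : 'cV[R]_n -> 'cV[R]_q) (tau : R) (F : R -> 'cV[R]_n -> 'cV[R]_n) :
  eigenbasis A lam e ->
  g =O_ (0 : 'cV[R]_n) (fun x => `|x| ^+ 2 : R^o) ->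
  flow_map (fun x => A *m x + g x) (p.-1%:R * tau) F ->
  0 < tau -> differentiable mu 0 ->
  let S := @delay_map R n p q mu F tau in
  differentiable S 0 /\ forall (w : 'cV[R[i]]_n) s,
    'd S 0 (map_mx (@complex.Re R) w) s 0 +i* 'd S 0 (map_mx (@complex.Im R) w) s 0 =
    modal_derivative mu (tagnat.sig1 s) (linflow lam e ((tagnat.sig2 s)%:R * tau) *m w).
Proof.
move=> eig gO flow tau0 dmu S.
have dF (j : 'I_p) : F (j%:R * tau) 0 = 0 /\ is_diff (0 : 'cV[R]_n) (F (j%:R * tau))
    (mulmx (map_mx (@complex.Re R) (linflow lam e (j%:R * tau)))).
  apply: (flow_is_diff eig gO flow).
  rewrite in_itv/= mulr_ge0 ?(ltW tau0)//= ler_wpM2r ?(ltW tau0)// ler_nat.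
  by case: j => j /=; case: (p).
have F0 j := (dF j).1; have dFj j := (dF j).2.
pose mul l : 'cV[R]_n -> R^o := fun x => mu x l 0.
have dmul l : differentiable (mul l) 0.
  exact: (@differentiable_comp _ _ _ _ mu (fun M => M l 0) 0 dmu
    (differentiable_coord _ _ _)).
have SE s : (fun x => S x s 0) =
    mul (tagnat.sig1 s) \o F ((tagnat.sig2 s)%:R * tau).
  by apply/funext => x; rewrite /S /delay_map !mxE.
have dmul' l (j : 'I_p) : differentiable (mul l) (F (j%:R * tau) 0).
  by rewrite F0.
have dS : differentiable S 0.
  by apply: differentiable_cV => s; rewrite SE; apply: differentiable_comp.
split=> // w s.
set j := tagnat.sig2 s; set l := tagnat.sig1 s.
set Q := map_mx (@complex.Re R) (linflow lam e (j%:R * tau)).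
have [dFs dFsE] : is_diff (0 : 'cV[R]_n) (F (j%:R * tau)) (mulmx Q) := dFj j.
have dSE v : 'd S 0 v s 0 = 'd (mul l) 0 (Q *m v).
  have E := congr1 (fun L => L v) (diff_comp dFs (dmul' l j)).
  rewrite (diff_coord v s dS) (SE s).
  refine (etrans E _).
  by rewrite /= F0 dFsE.
rewrite !dSE /modal_derivative (_ : linflow _ _ _ = map_mx (real_complex R) Q).
  by have [-> ->] := real_mulmx Q w.
exact: (linflow_real eig).
Qed.

Unset Implicit Arguments.

Theorem theorem3 (R : realType) (n d p q : nat) (l : smoothness)
    (A : 'M[R]_n) (g : 'cV[R]_n -> 'cV[R]_n)
    (lam : 'I_n -> R[i]) (e : 'I_n -> 'cV[R[i]]_n)
    (M : set 'cV[R]_n) (mu : 'cV[R]_n -> 'cV[R]_q)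
    (tau : R) (F : R -> 'cV[R]_n -> 'cV[R]_n)
    (hdn : (d <= n)%N) (hp : (0 < p)%N) (hl : l <> Cfin 0) (htau : 0 < tau)
    (f := fun x : 'cV[R]_n => A *m x + g x)
    (lam_d := fun k : 'I_d => lam (widen_ord hdn k))
    (e_d := fun k : 'I_d => e (widen_ord hdn k))
    (S := @delay_map R n p q mu F tau) :
  of_class l f ->
  g =O_ (0 : 'cV[R]_n) (fun x => `|x| ^+ 2 : R^o) ->
  eigenbasis A lam e ->
  injective lam_d ->
  submanifold d M ->
  invariant_set f M ->
  M 0 ->
  complexify (tangent_space M 0) = cspan e_d ->
  (forall x, differentiable mu x) ->
  flow_map f (p.-1%:R * tau) F ->
  C1_embedding M S ->
  complexify (tangent_space (S @` M) (S 0)) =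
  crange (\mxcol_(r < q) (delay_vandermonde p lam_d tau *m
            diag_mx (\row_(k < d) modal_derivative mu r (e_d k)))).
Proof.
move=> _ gO eig _ _ _ M0 TM dmu flow emb.
have [dS dSE] := delay_map_diff eig gO flow htau (dmu 0).
rewrite (tangent_space_image M0 dS emb).
set B := \mxcol_(r < q) _.
have BE (c : 'cV[R[i]]_d) s : (B *m c) s 0 = modal_derivative mu (tagnat.sig1 s)
    (linflow lam e ((tagnat.sig2 s)%:R * tau) *m \sum_k c k 0 *: e_d k).
  set t := (tagnat.sig2 s)%:R * tau.
  have -> : linflow lam e t *m \sum_k c k 0 *: e_d k =
      \sum_k (c k 0 * cexp (lam_d k * t%:C)) *: e_d k.
    rewrite mulmx_sumr; apply: eq_bigr => k _.
    by rewrite -scalemxAr (linflow_eig eig) scalerA.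
  rewrite modal_derivative_sum mxE; apply: eq_bigr => k _.
  have tE : (tagnat.sig2 s)%:R * lam_d k * tau%:C = lam_d k * t%:C.
    by rewrite /t rmorphM rmorph_nat/= mulrCA mulrA.
  by rewrite /B mxE mul_mx_diag [LHS]mulrC !mxE tE mulrA.
apply/seteqP; split=> y.
  move=> /complexify_image[w]; rewrite TM => -[c ->] yE.
  exists (\col_k c k) => //; apply/colP => s; rewrite yE BE [RHS]dSE.
  congr (modal_derivative _ _ (_ *m _)); apply: eq_bigr => k _; by rewrite mxE.
case=> c _ <-; apply/complexify_image.
exists (\sum_k c k 0 *: e_d k) => [|s]; first by rewrite TM; exists (fun k => c k 0).
by rewrite BE dSE.
Qed.
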